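(* Let $k\ge 1$, $\ell\ge 0$, $\beta\ge1$ be integers and let $1\le s_1<s_2<\dots<s_k$ and $1\le\alpha_1<\alpha_2<\dots<\alpha_\ell\le\lfloor\beta/2\rfloor$ be integers. For positive integers $n$ with $s_k\le\lfloor\beta n/2\rfloor$ for which the circulant graph $G_n=C_{\beta n}(s_1,\dots,s_k,\alpha_1n,\dots,\alpha_\ell n)$ is connected, let $\tau(n)$ be the number of spanning trees of $G_n$. Let $p$ and $q$ be the numbers of odd elements in the sequences $s_1,\dots,s_k$ and $\alpha_1,\dots,\alpha_\ell$ respectively. Let $r$ be the square-free part of $p$ and $s$ the square-free part of $p+q$. Then there exists an integer sequence $a(n)$ such that for all such $n$: (1) $\tau(n)=\beta\, n\, a(n)^2$ if $n$ and $\beta$ are odd; (2) $\tau(n)=\beta\, r\, n\, a(n)^2$ if $n$ is even; (3) $\tau(n)=\beta\, s\, n\, a(n)^2$ if $n$ is odd and $\beta$ is even.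
   Context: The square-free part of a positive integer $x$ is the unique square-free positive integer $y$ such that $x=y z^2$ for some positive integer $z$. (In case (2) connectedness of $G_n$ forces $p>0$, and in case (3) it forces $p+q>0$, so the square-free parts that are used are defined.) For integers $1\le c_1,\dots,c_r\le N/2$, the circulant graph $C_N(c_1,\dots,c_r)$ is the loopless multigraph on vertices $0,1,\dots,N-1$ in which each vertex $i$ is joined to $i\pm c_1,\dots,i\pm c_r \pmod N$, counted with multiplicity: the number of edges between distinct vertices $x$ and $y$ is the number of pairs $(j,\epsilon)$, $1\le j\le r$, $\epsilon\in\{+1,-1\}$, with $y\equiv x+\epsilon c_j \pmod N$. Thus every vertex has degree $2r$; in particular a jump $c_j=N/2$ produces double edges between opposite vertices, and coinciding jumps produce multiple edges. Equivalently, the Laplacian matrix is $2rI_N-\sum_{j=1}^r(T^{c_j}+T^{-c_j})$ where $T$ is the $N\times N$ cyclic shift permutation matrix. Spanning trees are counted with parallel edges regarded as distinct. $\ell=0$ means there are no jumps $\alpha_m n$. *)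

(* Defs.v *)
From HB Require Import structures.
From mathcomp Require Import all_boot all_order all_algebra.

Set Implicit Arguments.
Unset Strict Implicit.
Unset Printing Implicit Defensive.

(* Finite undirected multigraphs: edges are first-class, so parallel edges are
   distinct. The orientation given by the two endpoint maps is never used, see
   [joins]. *)
Record mgraph := MGraph {
  vertex : finType;
  edge : finType;
  end1 : edge -> vertex;
  end2 : edge -> vertex }.

Definition joins (G : mgraph) (e : edge G) (x y : vertex G) : bool :=
  (end1 e == x) && (end2 e == y) || (end1 e == y) && (end2 e == x).

Definition adjacent (G : mgraph) (F : {set edge G}) : rel (vertex G) :=
  fun x y => [exists e in F, joins e x y].

Definition connected_by (G : mgraph) (F : {set edge G}) : bool :=
  [forall x, forall y, connect (adjacent F) x y].

Definition connected (G : mgraph) : bool := connected_by [set: edge G].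

(* A cycle x_0 -e_0- x_1 -e_1- ... -e_{m-1}- x_0 with m >= 1, pairwise distinct
   vertices and pairwise distinct edges in F, is encoded as the sequence
   (x_0, e_0), ..., (x_{m-1}, e_{m-1}). A loop is a cycle with m = 1, and two
   parallel edges form a cycle with m = 2. *)
Definition is_cycle (G : mgraph) (F : {set edge G})
    (c : seq (vertex G * edge G)) : bool :=
  [&& c != [::],
      uniq (unzip1 c),
      uniq (unzip2 c),
      all (fun e => e \in F) (unzip2 c)
    & cycle (fun d d' => joins d.2 d.1 d'.1) c].

(* The length bound only serves decidability, see [acyclicP]. *)
Definition acyclic (G : mgraph) (F : {set edge G}) : bool :=
  [forall c : #|vertex G|.-bseq (vertex G * edge G)%type, ~~ is_cycle F c].

Lemma acyclicP (G : mgraph) (F : {set edge G}) :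
  reflect (forall c, ~~ is_cycle F c) (acyclic F).
Proof.
apply: (iffP forallP) => [noc c | noc c]; last exact: noc.
apply/negP => cc; have /and5P[_ u1 _ _ _] := cc.
have le_c : size c <= #|vertex G|.
  by rewrite -(size_map fst) -(card_uniqP u1) max_card.
by have := noc (Bseq le_c); rewrite /= cc.
Qed.

Definition spanning_tree (G : mgraph) (F : {set edge G}) : bool :=
  connected_by F && acyclic F.

Definition num_spanning_trees (G : mgraph) : nat :=
  #|[set F : {set edge G} | spanning_tree F]|.

Definition shift_mod (N : nat) (i : 'I_N) (c : nat) : 'I_N :=
  Ordinal (ltn_pmod (i + c) (leq_ltn_trans (leq0n i) (ltn_ord i))).

(* The circulant multigraph C_N(c_1, ..., c_r), for the jump sequence [cs]. The
   edge (i, j) joins i to i + c_j mod N; the neighbours i - c_j come from the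
   edges (i - c_j, j). In particular a jump N/2 yields two parallel edges
   between opposite vertices. The multiplicities are given by
   [card_joins_circulant]. *)
Definition circulant (N : nat) (cs : seq nat) : mgraph :=
  @MGraph 'I_N ('I_N * 'I_(size cs))%type
    (fun e => e.1)
    (fun e => shift_mod e.1 (nth 0 cs e.2)).

Lemma shift_modE (N : nat) (x y : 'I_N) (c : nat) :
  (shift_mod x c == y) = (y == x + c %[mod N]).
Proof. by rewrite -val_eqE /= [RHS]eq_sym [y %% N]modn_small. Qed.

(* For the pair (j, eps), eps = true stands for y = x + c_j mod N and
   eps = false for y = x - c_j mod N. *)
Lemma card_joins_circulant (N : nat) (cs : seq nat) (x y : 'I_N) :
  x != y ->
  #|[set e : edge (circulant N cs) | @joins (circulant N cs) e x y]| =
  #|[set p : 'I_(size cs) * bool |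
      if p.2 then y == x + nth 0 cs p.1 %[mod N]
      else y + nth 0 cs p.1 == x %[mod N]]|.
Proof.
move=> neq_xy.
pose f (p : 'I_(size cs) * bool) : 'I_N * 'I_(size cs) :=
  ((if p.2 then x else y), p.1).
have f_inj : injective f.
  move=> [j b] [j' b'] /= [].
  by case: b; case: b' => E -> //; move: neq_xy; rewrite E eqxx.
rewrite -(card_imset _ f_inj); apply: eq_card => -[i j].
rewrite inE /joins /= !shift_modE.
apply/idP/imsetP => [/orP[]/andP[/eqP-> jy]|[[j' b]]].
- by exists (j, true); rewrite ?inE.
- by exists (j, false); rewrite ?inE //= eq_sym.
rewrite inE /f /= => h [-> ->]; case: b h => /= h.
  by rewrite eqxx h.
by rewrite eqxx (eq_sym (x %% N)) h orbT.
Qed.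

Definition square_free (y : nat) : bool :=
  (0 < y) && [forall d : 'I_y.+1, (d ^ 2 %| y) ==> (d == 1 :> nat)].

Definition is_sqfree_part (x y : nat) : bool :=
  square_free y && [exists z : 'I_x.+1, (0 < z) && (x == y * z ^ 2)].

(* The square-free part of x > 0, see [sqfree_partP] and
   [is_sqfree_part_uniq]; the value at 0 is the junk value 0. *)
Definition sqfree_part (x : nat) : nat :=
  if [pick y : 'I_x.+1 | is_sqfree_part x y] is Some y then val y else 0.

Lemma square_freeP (y : nat) :
  reflect (0 < y /\ forall d, d ^ 2 %| y -> d = 1) (square_free y).
Proof.
apply: (iffP andP) => -[y0 sf]; split=> //.
  move=> d dy; have dd : d %| y by apply: dvdn_trans dy; rewrite dvdn_mulr.
  have lt_d : d < y.+1 by rewrite ltnS dvdn_leq.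
  by apply/eqP; have /forallP/(_ (Ordinal lt_d)) := sf; rewrite /= dy.
by apply/forallP => d; apply/implyP => /sf ->.
Qed.

Lemma is_sqfree_partP (x y : nat) : 0 < x ->
  reflect (square_free y /\ exists z, 0 < z /\ x = y * z ^ 2)
          (is_sqfree_part x y).
Proof.
move=> x0; apply: (iffP andP) => -[sf].
  by move=> /existsP[z /andP[z0 /eqP xE]]; split=> //; exists z.
move=> [z [z0 xE]]; split=> //; apply/existsP.
have lt_z : z < x.+1.
  by rewrite ltnS dvdn_leq // xE dvdn_mull // dvdn_mulr.
by exists (Ordinal lt_z); rewrite /= z0 -xE eqxx.
Qed.

Lemma sqfree_partP (x : nat) : 0 < x -> is_sqfree_part x (sqfree_part x).
Proof.
move=> x0; rewrite /sqfree_part; case: pickP => [y //|noy]; exfalso.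
pose P z := (0 < z) && (z ^ 2 %| x).
have exP : exists z, P z by exists 1; rewrite /P /= dvd1n.
have leP z : P z -> z <= x.
  case/andP=> z0 zx; apply: dvdn_leq => //; apply: dvdn_trans zx.
  by rewrite dvdn_mulr.
case: (ex_maxnP exP leP) => z /andP[z0 /dvdnP[y xE]] zmax.
have y0 : 0 < y by move: x0; rewrite xE muln_gt0 => /andP[].
have lt_y : y < x.+1 by rewrite ltnS dvdn_leq // xE dvdn_mulr.
suff: is_sqfree_part x y by have /= -> := noy (Ordinal lt_y).
apply/is_sqfree_partP => //; split; last by exists z.
apply/square_freeP; split=> // d /dvdnP[u yE].
have d0 : 0 < d by move: y0; rewrite yE muln_gt0 expn_gt0 orbF => /andP[].
have := zmax (d * z); rewrite /P muln_gt0 d0 z0 xE yE -mulnA -expnMn.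
rewrite dvdn_mull //= => /(_ isT); rewrite -[X in _ <= X]mul1n leq_pmul2r //.
by move=> d1; apply/eqP; rewrite eqn_leq d1 d0.
Qed.

Lemma is_sqfree_part_uniq (x y y' : nat) : 0 < x ->
  is_sqfree_part x y -> is_sqfree_part x y' -> y = y'.
Proof.
move=> x0.
have main u v : is_sqfree_part x u -> is_sqfree_part x v -> u %| v.
  move=> /(is_sqfree_partP _ x0)[/square_freeP[u0 sfu] [z [z0 xu]]].
  move=> /(is_sqfree_partP _ x0)[/square_freeP[v0 sfv] [w [w0 xv]]].
  apply/dvdn_partP => // p; rewrite mem_primes => /and3P[pp _ pu].
  have lu : logn p u <= 1.
    rewrite leqNgt -(pfactor_dvdn _ pp) //; apply/negP => /sfu p1.
    by rewrite p1 in pp.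
  have lE a b : 0 < a -> 0 < b -> logn p (a * b ^ 2) = logn p a + 2 * logn p b.
    by move=> a0 b0; rewrite lognM ?expn_gt0 ?b0 // lognX.
  have := congr1 (logn p) xu; rewrite xv !lE //.
  rewrite p_part pfactor_dvdn //.
  case: (logn p u) lu => [//|[|//] _] eq1.
  have : odd (logn p v + 2 * logn p w) by rewrite eq1 oddD mul2n odd_double.
  by rewrite oddD mul2n odd_double addbF; case: (logn p v).
by move=> hy hy'; apply/eqP; rewrite eqn_dvd !main.
Qed.

(* Main.v *)
Require Import Defs.
From mathcomp Require Import all_boot all_order all_algebra all_field.
From mathcomp Require Import ring zify.

(** Let [N = beta * n], let [w] be a primitive [N]-th root of unity, and put
    [t_j = w^j + w^-j]. By the matrix-tree theorem [N * tau(n)] is the product of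
    the nonzero-index eigenvalues [sum_c (2 - w^(j c) - w^(-j c))], [0 < j < N],
    of the Laplacian. Each summand is [2 - t_j = (1 - w^j) (1 - w^-j)] times
    [d_c(t_j)] for an integer polynomial [d_c] ([eigen_quot]), and the factors
    [1 - w^j] multiply to [N]; so [tau(n) = N * prod_(0 < j < N) g(t_j)] with
    [g = sum_c d_c] ([num_spanning_trees_eigen_quot]).

    Since [t_j = t_(N - j)], the product is the square of the half product
    [b = prod_(1 <= j <= m) g(t_j)], [m = (N - 1) %/ 2], except that for even [N]
    the index [j = N / 2] is left over. There [t_j = -2], and [d_c(-2)] is 1 for
    odd [c] and 0 for even [c], so the extra factor is the number of odd jumps:
    [p] if [n] is even, and [p + q] if [n] is odd. Removing the square-free part
    leaves a square. The half product [b] is an integer because [t_1], ..., [t_m]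
    are the roots of a monic integer polynomial ([pair_poly]): [b] is the
    determinant of [g] at its companion matrix ([prod_over_roots_int]).

    The matrix-tree theorem is proved by deletion and contraction, in a form that
    never changes the vertex set: instead of contracting an edge between a vertex
    of a root set [S] and a vertex [v] outside [S], [v] is added to [S]. Both the
    number of spanning forests rooted at [S] and the determinant of the Laplacian
    without the rows and columns of [S] obey the same recursion
    ([card_forests_crossing], [det_rooted_crossing]). Forests are counted through
    their number of edges, which for connected subgraphs is equivalent to the
    absence of cycles ([spanning_treeE]). *)

Set Implicit Arguments.
Unset Strict Implicit.
Unset Printing Implicit Defensive.
Import Order.TTheory GRing.Theory Num.Theory.

(** * Spanning trees and rooted forests *)

Section RootedForests.

Variable G : mgraph.
Implicit Types (F T : {set edge G}) (S : {set vertex G}) (x y u v : vertex G).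

Lemma joins_sym (e : edge G) x y : joins e x y = joins e y x.
Proof. by rewrite /joins orbC. Qed.

Lemma joins_ends (e : edge G) u v x y :
  joins e u v -> joins e x y -> (x = u /\ y = v) \/ (x = v /\ y = u).
Proof.
by rewrite /joins; case/orP=> /andP[/eqP-> /eqP->];
  case/orP=> /andP[/eqP-> /eqP->]; auto.
Qed.

Lemma adjacent_sym F : symmetric (adjacent F).
Proof. by move=> x y; apply: eq_existsb => e; rewrite joins_sym. Qed.

Lemma connect_adjacent_sym F : connect_sym (adjacent F).
Proof. exact: sym_connect_sym (@adjacent_sym F). Qed.

Lemma connect_joins F (e : edge G) x y :
  e \in F -> joins e x y -> connect (adjacent F) x y.
Proof. by move=> eF exy; apply/connect1/existsP; exists e; rewrite eF. Qed.

Lemma connect_adjacentS F T x y :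
  T \subset F -> connect (adjacent T) x y -> connect (adjacent F) x y.
Proof.
move=> /subsetP TF; apply: connect_sub => u v /existsP[e /andP[/TF eF]].
exact: connect_joins.
Qed.

Lemma connect_in F (A : {pred vertex G}) :
  (forall e u v, e \in F -> joins e u v -> u \in A -> v \in A) ->
  forall x y, connect (adjacent F) x y -> x \in A -> y \in A.
Proof.
move=> clA x y xy; rewrite (closed_connect _ xy) //.
apply: intro_closed; first exact: connect_adjacent_sym.
by move=> u v /existsP[e /andP[eF euv]]; apply: clA euv.
Qed.

Definition spans F S := [forall y, [exists x in S, connect (adjacent F) x y]].

Lemma spansP F S :
  reflect (forall y, exists2 x, x \in S & connect (adjacent F) x y)
          (spans F S).
Proof. by apply: (iffP forallP) => sp y; apply/exists_inP. Qed.

Lemma spans_setT F : spans F setT.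
Proof. by apply/spansP=> y; exists y; rewrite ?inE ?connect0. Qed.

Definition crossing S (e : edge G) := (end1 e \in S) != (end2 e \in S).

Lemma crossingP S (e : edge G) :
  reflect (exists u v, [/\ joins e u v, u \in S & v \notin S]) (crossing S e).
Proof.
rewrite /crossing; apply: (iffP idP) => [|[u [v [euv uS vS]]]].
  case u1: (end1 e \in S); case u2: (end2 e \in S) => // _.
    by exists (end1 e), (end2 e); rewrite /joins !eqxx u2.
  by exists (end2 e), (end1 e); rewrite /joins !eqxx orbT u1.
by case/orP: euv => /andP[/eqP-> /eqP->]; rewrite uS (negPf vS).
Qed.

(** Every vertex reachable through [e] is reachable without [e] once its far
    end is a root as well. *)
Lemma spans_cross F S (e : edge G) u v :
  e \in F -> joins e u v -> u \in S -> spans F S = spans (F :\ e) (v |: S).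
Proof.
move=> eF euv uS; apply/spansP/spansP=> sp y; last first.
  have [x] := sp y; have Fe : F :\ e \subset F by rewrite subsetDl.
  rewrite !inE => /orP[/eqP->|xS] /(connect_adjacentS Fe) xy; last by exists x.
  by exists u => //; apply: connect_trans xy; apply: connect_joins euv.
have [x xS xy] := sp y.
(* [A] is closed under [e] too, because both ends of [e] are roots. *)
pose A := [pred z | [exists w in v |: S, connect (adjacent (F :\ e)) w z]].
suff /exists_inP[w] : y \in A by exists w.
apply: (connect_in _ xy); last first.
  by apply/exists_inP; exists x; rewrite ?inE ?xS ?orbT ?connect0.
move=> f a b fF fab /exists_inP[w wS wa]; apply/exists_inP.
have [fe|nfe] := eqVneq f e; last first.
  exists w => //; apply: connect_trans wa _; apply: connect_joins fab.
  by rewrite !inE nfe.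
exists b; rewrite ?connect0 //; move: fab; rewrite fe => fab.
by case: (joins_ends euv fab) => -[_ ->]; rewrite !inE ?uS ?eqxx ?orbT.
Qed.

Lemma spans_crossing F S :
  spans F S -> S != setT -> exists2 e, e \in F & crossing S e.
Proof.
move=> /spansP sp nST; apply/exists_inP; apply: contraNT nST => /exists_inPn no.
apply/eqP/setP=> y; rewrite inE; have [x xS xy] := sp y.
apply: (connect_in _ xy xS) => e u v eF euv uS; apply: contraT => vS.
by case/negP: (no e eF); apply/crossingP; exists u, v.
Qed.

Lemma card_setC_setU1 S v : v \notin S -> #|~: S| = #|~: (v |: S)|.+1.
Proof.
move=> vS; rewrite (cardsD1 v) inE vS add1n; congr _.+1.
by apply: eq_card => x; rewrite !inE negb_or.
Qed.

(** Growing the root set along crossing edges extracts a spanning forest. *)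
Lemma spans_minimal F S :
  spans F S -> exists T, [/\ T \subset F, spans T S & #|T| = #|~: S|].
Proof.
move En: #|~: S| => n; elim: n S F En => [|n IHn] S F En sp.
  exists set0; rewrite sub0set cards0; split=> //.
  move/eqP: En; rewrite cards_eq0 => /eqP SC.
  by rewrite -(setCK S) SC setC0 spans_setT.
have nST : S != setT by apply: contra_eqN En => /eqP->; rewrite setCT cards0.
have [e eF /crossingP[u [v [euv uS vS]]]] := spans_crossing sp nST.
have cS : #|~: (v |: S)| = n by move: En; rewrite (card_setC_setU1 vS) => -[].
have := IHn _ (F :\ e) cS; rewrite -(spans_cross eF euv uS).
move=> /(_ sp)[T [TF Tsp cT]].
have /subsetD1P[TF' eT] := TF.
exists (e |: T); split; first by rewrite subUset sub1set eF.
- by rewrite (spans_cross _ euv uS) ?setU11 // setU1K.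
- by rewrite cardsU1 eT cT.
Qed.

Lemma spans_card F S : spans F S -> #|~: S| <= #|F|.
Proof. by move=> /spans_minimal[T [TF _ <-]]; apply: subset_leq_card. Qed.

(** The subsets of [F] counted here are the spanning forests with exactly one
    vertex of [S] in each component: a spanning set has at least one such vertex
    in each component, and the number of edges forces the rest. *)
Definition forests F S :=
  [set T : {set edge G} | [&& T \subset F, spans T S & #|T| == #|~: S|]].

Lemma forests_setT F : forests F setT = [set set0].
Proof.
apply/setP=> T; rewrite !inE spans_setT setCT cards0 cards_eq0 andTb.
by case: eqP => [->|]; rewrite ?sub0set ?andbF.
Qed.

Lemma forests_no_crossing F S :
  S != setT -> (forall e, e \in F -> ~~ crossing S e) -> forests F S = set0.
Proof.
move=> nST no; apply/setP=> T; rewrite !inE; apply/negP => /and3P[TF Tsp _].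
have [e /(subsetP TF) eF] := spans_crossing Tsp nST.
exact/negP/no.
Qed.

(** Deletion and contraction: a forest containing [e] is the same as a forest
    without [e] in which the far end of [e] has become a root. *)
Lemma card_forests_crossing F S (e : edge G) u v :
    e \in F -> joins e u v -> u \in S -> v \notin S ->
  #|forests F S| = #|forests (F :\ e) S| + #|forests (F :\ e) (v |: S)|.
Proof.
move=> eF euv uS vS; rewrite -(cardsID [set T : {set edge G} | e \in T]) addnC.
congr (_ + _).
  apply: eq_card => T; rewrite !inE subsetD1.
  by case: (e \in T); rewrite /= ?andbF ?andbT.
have addK T : T \in forests (F :\ e) (v |: S) -> e \notin T.
  by rewrite inE => /and3P[/subsetD1P[]].
rewrite -[RHS](card_in_imset (f := fun T => e |: T)); last first.
  by move=> T T' /addK eT /addK eT' E; rewrite -(setU1K eT) -(setU1K eT') E.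
apply: eq_card => T; rewrite !inE; apply/andP/imsetP.
  move=> [/and3P[TF Tsp cT] eT].
  exists (T :\ e); last by rewrite setD1K.
  rewrite inE setSD // -(spans_cross eT euv uS) Tsp /=.
  by move: cT; rewrite (card_setC_setU1 vS) (cardsD1 e) eT.
case=> T' T'F ->; have eT' := addK _ T'F.
move: T'F; rewrite inE => /and3P[/subsetD1P[T'F _] T'sp /eqP cT'].
rewrite setU11 subUset sub1set eF T'F (spans_cross _ euv uS) ?setU11 //.
by rewrite setU1K // T'sp cardsU1 eT' cT' (card_setC_setU1 vS) eqxx.
Qed.

Lemma connected_by_spans F x : connected_by F = spans F [set x].
Proof.
apply/forallP/spansP=> [cF y | sp y].
  by exists x; rewrite ?inE //; apply: (forallP (cF x)).
have xto z : connect (adjacent F) x z by have [w /set1P->] := sp z.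
apply/forallP=> z; apply: connect_trans (xto z).
by rewrite connect_adjacent_sym.
Qed.

(** The step relation in the definition of [is_cycle]. *)
Let step (d d' : vertex G * edge G) := joins d.2 d.1 d'.1.

Lemma connect_steps F d c d0 :
  all (fun e => e \in F) (unzip2 (d :: c)) -> path step d (rcons c d0) ->
  connect (adjacent F) d.1 d0.1.
Proof.
elim: c d => [|d' c IHc] d /=.
  by rewrite !andbT => dF /(connect_joins dF).
case/andP=> dF c_F /andP[dd' c_path].
by apply: connect_trans (IHc d' c_F c_path); apply: connect_joins dd'.
Qed.

(** The other edges of the cycle still connect the ends of the removed one. *)
Lemma is_cycle_removable F c :
  is_cycle F c -> exists2 e, e \in F & connected_by F -> connected_by (F :\ e).
Proof.
case: c => [|[x e] c] //=; rewrite /is_cycle /= => /and4P[_ /andP[ec _]].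
case/andP=> eF /allP cF cyc; exists e => // /forallP conn.
have cFe : all (fun f => f \in F :\ e) (unzip2 c).
  apply/allP=> f fc; rewrite !inE (cF f fc) andbT.
  by apply: contraNneq ec => <-.
have [z exz zx] : exists2 z, joins e x z & connect (adjacent (F :\ e)) z x.
  case: c cyc cFe {cF ec} => [|d c] /= /andP[exd cyc] cFe.
    by exists x; rewrite ?connect0.
  by exists d.1 => //; exact: (connect_steps cFe cyc).
apply/forallP=> a; apply/forallP=> b; have := forallP (conn a) b.
apply: connect_sub => {}a {}b /existsP[f /andP[fF fab]].
have [fe|nfe] := eqVneq f e; last first.
  by apply: connect_joins fab; rewrite !inE nfe.
rewrite fe in fab; case: (joins_ends exz fab) => -[-> ->] //.
by rewrite connect_adjacent_sym.
Qed.

(** The invariant on the ends of the edges makes them pairwise distinct: an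
    edge at the first vertex of a simple path is not used again. *)
Lemma path_steps F y p :
    path (adjacent F) y p -> uniq (y :: p) ->
  exists c, [/\ unzip1 c = belast y p, uniq (unzip2 c),
    all (fun e => e \in F) (unzip2 c),
    all (fun e => (end1 e \in y :: p) && (end2 e \in y :: p)) (unzip2 c)
  & forall d d0, step d (y, d.2) -> d0.1 = last y p -> path step d (rcons c d0)].
Proof.
elim: p y => [|z p IHp] y.
  move=> _ _; exists [::]; split=> // d d0; rewrite /step /= andbT => dy ->.
  exact: dy.
rewrite [path _ _ _]/= => /andP[/existsP[e /andP[eF eyz]] zp].
rewrite cons_uniq => /andP[yzp /(IHp z zp)[c [c1 c2 cF cends cpath]]].
exists ((y, e) :: c); split; rewrite /= ?c1 ?c2 ?eF //.
- rewrite andbT; apply: contra yzp => /(allP cends) /andP[e1 e2].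
  by case/orP: eyz => /andP[] => [/eqP<- _|_ /eqP<-].
- have zzp : z \in z :: p by rewrite mem_head.
  apply/andP; split.
    by case/orP: eyz => /andP[/eqP-> /eqP->]; rewrite mem_head in_cons zzp orbT.
  apply: sub_all cends => f /andP[f1 f2].
  by rewrite !(in_cons y) f1 f2 !orbT.
- by move=> d d0 dy d0p; rewrite [step _ _]dy cpath.
Qed.

(** A path in [T] between the ends of [e], made simple, closes up with [e] to a
    cycle. *)
Lemma acyclic_endpoints F T (e : edge G) :
    acyclic F -> T \subset F -> e \in F -> e \notin T ->
  ~~ connect (adjacent T) (end2 e) (end1 e).
Proof.
move=> /acyclicP acF /subsetP TF eF eT; apply/negP => /connectP[p0 p0T lastp0].
case/shortenP: p0T lastp0 => p pT up _ lastp.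
have [c [c1 c2 cT _ cpath]] := path_steps pT up.
have /negP[] := acF ((end1 e, e) :: c).
apply/and5P; split=> //=.
- by rewrite c1 lastp -rcons_uniq -lastI.
- by rewrite c2 andbT; apply: contra eT => /(allP cT).
- by rewrite eF; apply: sub_all cT.
- by apply: cpath; rewrite /step //= /joins !eqxx.
Qed.

(** A connected set has at least [#|V| - 1] edges. An edge of a cycle can be
    removed, so a connected set with exactly this many edges is acyclic.
    Conversely a connected set contains a connected set with exactly this many
    edges, and any further edge would close a cycle. *)
Lemma spanning_treeE F x :
  spanning_tree F = spans F [set x] && (#|F| == #|~: [set x]|).
Proof.
rewrite /spanning_tree; have [cF|] := boolP (connected_by F); last first.
  by rewrite (connected_by_spans F x) => /negPf->.
rewrite -connected_by_spans cF /=; apply/idP/idP=> [acF|/eqP cardF].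
  move: (cF); rewrite (connected_by_spans F x) => /spans_minimal[T [TF Tsp <-]].
  have [FT|/subsetPn[e eF eT]] := boolP (F \subset T).
    by rewrite eqn_leq !subset_leq_card.
  case/negP: (acyclic_endpoints acF TF eF eT).
  by move: Tsp; rewrite -connected_by_spans => /forallP/(_ _)/forallP.
apply/acyclicP=> c; apply/negP => /is_cycle_removable[e eF /(_ cF)].
rewrite (connected_by_spans _ x) => /spans_card.
by rewrite -cardF (cardsD1 e F) eF ltnn.
Qed.

Lemma num_spanning_trees_forests x :
  num_spanning_trees G = #|forests setT [set x]|.
Proof.
by apply: eq_card => F; rewrite !inE (spanning_treeE F x) subsetT.
Qed.

End RootedForests.

(** * The matrix-tree theorem *)

Lemma det_kernel (R : comPzRingType) n (A : 'M[R]_n) (x : 'cV[R]_n) i :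
  (A *m x = 0 -> x i 0 = 1 -> \det A = 0)%R.
Proof.
move=> Ax xi; have := congr1 (fun y => (\adj A *m y)%R i ord0) Ax.
by rewrite mulmxA mul_adj_mx mulmx0 mul_scalar_mx !mxE xi mulr1.
Qed.

Lemma row'_congr (R : Type) m n (A B : 'M[R]_(m, n)) i :
  (forall k j, k != i -> A k j = B k j) -> row' i A = row' i B.
Proof.
by move=> AB; apply/matrixP=> k j; rewrite !mxE AB // eq_sym neq_lift.
Qed.

Section MatrixTree.

Local Open Scope ring_scope.

Variables (n : nat) (E : finType) (a b : E -> 'I_n).
Let G := MGraph a b.
Implicit Types (F : {set E}) (S : {set 'I_n}).

Definition laplacian F : 'M[int]_n :=
  \matrix_(i, j) \sum_(e in F)
    ((i == a e)%:R - (i == b e)%:R) * ((j == a e)%:R - (j == b e)%:R).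

(** Deleting the rows and columns of [laplacian F] indexed by [S] leaves the
    same determinant; the size of this matrix does not depend on [S]. *)
Definition rooted_laplacian F S : 'M[int]_n :=
  \matrix_(i, j) if i \in S then (i == j)%:R else laplacian F i j.

Lemma laplacian_mul F (R : comPzRingType) (x : 'I_n -> R) i :
  \sum_j (laplacian F i j)%:~R * x j =
  \sum_(e in F) ((i == a e)%:R - (i == b e)%:R) * (x (a e) - x (b e)).
Proof.
have delta k : \sum_j (j == k)%:R * x j = x k.
  rewrite (bigD1 k) //= eqxx mul1r big1 ?addr0 // => j /negPf->.
  by rewrite mul0r.
under eq_bigr => j _ do rewrite mxE rmorph_sum mulr_suml.
rewrite exchange_big /=; apply: eq_bigr => e _.
rewrite -[in RHS](delta (a e)) -[in RHS](delta (b e)) -sumrB mulr_sumr.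
apply: eq_bigr => j _.
by rewrite !(rmorphM, rmorphB) /= !rmorph_nat -mulrBl mulrA.
Qed.

Lemma laplacian_sum F i : \sum_j laplacian F i j = 0.
Proof.
transitivity (\sum_j (laplacian F i j)%:~R * 1 : int).
  by apply: eq_bigr => j _; rewrite mulr1 intz.
by rewrite (laplacian_mul F (fun=> 1)) big1 // => e _; rewrite subrr mulr0.
Qed.

Lemma rooted_laplacian_setT F : rooted_laplacian F setT = 1%:M.
Proof. by apply/matrixP=> i j; rewrite !mxE inE. Qed.

(** The indicator vector of the complement of [S] is in the kernel. *)
Lemma det_rooted_no_crossing F S :
    S != setT -> (forall e, e \in F -> ~~ @crossing G S e) ->
  \det (rooted_laplacian F S) = 0.
Proof.
move=> nST no; have [i iS] : exists i, i \notin S.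
  apply/existsP; apply: contraNT nST => /existsPn allS.
  by apply/eqP/setP=> i; rewrite inE; have := allS i; rewrite negbK.
apply: (det_kernel (x := \col_j (j \notin S)%:R) (i := i));
  last by rewrite mxE iS.
apply/matrixP=> {iS}i j; rewrite [in RHS]mxE mxE.
under eq_bigr => k _ do rewrite !mxE.
case: (boolP (i \in S)) => iS.
  rewrite (bigD1 i) //= eqxx iS mulr0 add0r big1 // => k.
  by rewrite eq_sym => /negPf->; rewrite mul0r.
transitivity (\sum_k (laplacian F i k)%:~R * (k \notin S)%:R : int).
  by apply: eq_bigr => k _; rewrite intz mxE.
rewrite laplacian_mul big1 // => e eF; have := no e eF.
by rewrite /crossing negbK /= => /eqP->; rewrite subrr mulr0.
Qed.

Lemma laplacianD1 F e i j : e \in F ->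
  laplacian F i j = laplacian (F :\ e) i j +
    ((i == a e)%:R - (i == b e)%:R) * ((j == a e)%:R - (j == b e)%:R).
Proof.
move=> eF; rewrite !mxE (big_setD1 e) //= addrC; congr (_ + _).
Qed.

(** Row [v] is the only one that [e] changes, by [delta_v - delta_u]. The
    determinant is linear in this row, and since row [u] is [delta_u], the change
    is as good as [delta_v], which turns [v] into a root. *)
Lemma det_rooted_crossing F S e u v :
    e \in F -> @joins G e u v -> u \in S -> v \notin S ->
  \det (rooted_laplacian F S) =
  \det (rooted_laplacian (F :\ e) S) + \det (rooted_laplacian (F :\ e) (v |: S)).
Proof.
move=> eF euv uS vS.
have uv : u != v by apply: contraNneq vS => <-.
have LF i j : laplacian F i j = laplacian (F :\ e) i j +
    ((i == v)%:R - (i == u)%:R) * ((j == v)%:R - (j == u)%:R).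
  rewrite (laplacianD1 _ _ eF); congr (_ + _).
  by case/orP: euv => /andP[/= /eqP-> /eqP->] //; rewrite -[RHS]mulrNN !opprB.
pose C w := \matrix_(i, j)
  if i == v then (j == w)%:R else rooted_laplacian (F :\ e) S i j : int.
pose D := \matrix_(i, j) if i == v then (j == v)%:R - (j == u)%:R
  else rooted_laplacian (F :\ e) S i j : int.
have -> : rooted_laplacian (F :\ e) (v |: S) = C v.
  apply/matrixP=> i j; rewrite !mxE !inE; case: eqVneq => //= ->.
  by rewrite eq_sym.
have detCu : \det (C u) = 0.
  apply: (determinant_alternate uv) => j.
  by rewrite !mxE eqxx (negPf uv) uS eq_sym.
have -> : \det (rooted_laplacian F S) =
    1 * \det (rooted_laplacian (F :\ e) S) + 1 * \det D.
  apply: (determinant_multilinear (i0 := v)).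
  - apply/rowP=> j; rewrite !mxE (negPf vS) !mul1r eqxx.
    have := LF v j; rewrite !mxE eqxx [v == u]eq_sym (negPf uv) subr0 mul1r.
    exact.
  - apply: row'_congr => k j kv; rewrite !mxE; case: ifP => // kS.
    have := LF k j; rewrite !mxE (negPf kv).
    have /negPf-> : k != u by apply: contraFneq kS => ->.
    by rewrite subrr mul0r addr0.
  - apply: row'_congr => k j kv; rewrite !mxE (negPf kv); case: ifP => // kS.
    have := LF k j; rewrite !mxE (negPf kv).
    have /negPf-> : k != u by apply: contraFneq kS => ->.
    by rewrite subrr mul0r addr0.
have -> : \det D = 1 * \det (C v) + (-1) * \det (C u).
  apply: (determinant_multilinear (i0 := v)).
  - by apply/rowP=> j; rewrite !mxE eqxx mul1r mulN1r.
  - by apply: row'_congr => k j kv; rewrite !mxE (negPf kv).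
  - by apply: row'_congr => k j kv; rewrite !mxE (negPf kv).
by rewrite detCu mulr0 addr0 !mul1r.
Qed.

(** Both sides satisfy the deletion recursion along crossing edges. Without
    crossing edges both vanish, unless every vertex is a root and both are 1. *)
Theorem rooted_matrix_tree F S :
  \det (rooted_laplacian F S) = #|@forests G F S|%:R.
Proof.
move Ec: #|F| => c; elim: c F S Ec => [|c IHc] F S Ec;
  have [->|nST] := eqVneq S setT.
- by rewrite rooted_laplacian_setT det1 forests_setT cards1.
- move/eqP: Ec; rewrite cards_eq0 => /eqP->.
  by rewrite det_rooted_no_crossing ?forests_no_crossing ?cards0 // => e;
    rewrite inE.
- by rewrite rooted_laplacian_setT det1 forests_setT cards1.
have [/exists_inP[e eF]|/exists_inPn no] :=
  boolP [exists e in F, @crossing G S e].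
  case/crossingP=> u [v [euv uS vS]].
  have cF : #|F :\ e| = c by move: Ec; rewrite (cardsD1 e) eF => -[].
  rewrite (det_rooted_crossing eF euv uS vS).
  rewrite (@card_forests_crossing G _ _ _ _ _ eF euv uS vS).
  by rewrite natrD !IHc.
by rewrite det_rooted_no_crossing ?forests_no_crossing ?cards0.
Qed.

Corollary matrix_tree x :
  \det (rooted_laplacian setT [set x]) = (num_spanning_trees G)%:R.
Proof. by rewrite rooted_matrix_tree (@num_spanning_trees_forests G x). Qed.

End MatrixTree.

(** * The spectrum of a circulant graph *)

Local Open Scope ring_scope.

(** Row [0] on the left is [n + 1] times the unit row of the rooted Laplacian plus
    a row with zero sum. With the latter as row [0] all row sums vanish, so it
    contributes nothing to the determinant. *)
Lemma det_laplacian_row0 n (E : finType) (a b : E -> 'I_n.+1) :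
  \det (laplacian a b setT + \matrix_(i, j) (i == ord0)%:R) =
  n.+1%:R * \det (rooted_laplacian a b setT [set ord0]).
Proof.
set L := laplacian a b setT; set P := rooted_laplacian _ _ _ _.
pose Q := L + \matrix_(i, j) ((i == ord0)%:R * (1 - n.+1%:R * (j == ord0)%:R)).
have Q0 : \det Q = 0.
  apply: (det_kernel (x := const_mx 1) (i := ord0)); last by rewrite mxE.
  apply/matrixP=> i j; rewrite [LHS]mxE [RHS]mxE.
  transitivity (\sum_k (L i k + (i == ord0)%:R * (1 - n.+1%:R * (k == ord0)%:R))).
    by apply: eq_bigr => k _; rewrite !mxE mulr1.
  rewrite big_split /= laplacian_sum add0r -mulr_sumr sumrB -mulr_sumr.
  rewrite sumr_const card_ord (bigD1 ord0) //= big1 => [|k /negPf-> //].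
  by rewrite addr0 mulr1 subrr mulr0.
transitivity (n.+1%:R * \det P + 1 * \det Q); last by rewrite Q0 mulr0 addr0.
apply: (determinant_multilinear (i0 := ord0)).
- apply/rowP=> j; rewrite !mxE inE !eqxx !mul1r [ord0 == j]eq_sym.
  by rewrite /=; ring.
- by apply: row'_congr => k j /negPf k0; rewrite !mxE inE k0 addr0.
- by apply: row'_congr => k j /negPf k0; rewrite !mxE k0 mul0r.
Qed.

Lemma root_of_unity_neq0 (F : fieldType) N (z : F) :
  (0 < N)%N -> z ^+ N = 1 -> z != 0.
Proof.
move=> N0; apply: contra_eqN => /eqP->.
by rewrite expr0n eqn0Ngt N0 eq_sym oner_eq0.
Qed.

Lemma prim_root_neq0 (F : fieldType) N (w : F) : N.-primitive_root w -> w != 0.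
Proof.
move=> prim_w; apply: root_of_unity_neq0 (prim_expr_order prim_w).
exact: prim_order_gt0 prim_w.
Qed.

Lemma prim_expr_sub (F : fieldType) N (w : F) j :
  N.-primitive_root w -> (j <= N)%N -> w ^+ (N - j) = w ^- j.
Proof.
move=> prim_w jN; have wj0 := expf_neq0 j (prim_root_neq0 prim_w).
apply: (mulfI wj0); rewrite mulfV // -exprD subnKC //.
exact: prim_expr_order prim_w.
Qed.

Section Eigenvalues.

Variable F : fieldType.

Definition circ_eigenvalue (cs : seq nat) (z : F) :=
  \sum_(c <- cs) (2%:R - z ^+ c - z ^- c).

Lemma circulant_laplacian_mul N cs (z : F) (i : 'I_N) : z ^+ N = 1 ->
  \sum_j (laplacian (@end1 (circulant N cs)) (@end2 (circulant N cs)) setT i j)%:~R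
    * z ^+ j = circ_eigenvalue cs z * z ^+ i.
Proof.
move=> zN; have N0 : (0 < N)%N by case: N i {zN} => [[]|].
have z0 := root_of_unity_neq0 N0 zN.
rewrite (laplacian_mul _ _ _ (fun j : 'I_N => z ^+ j)) /=.
rewrite (eq_bigl xpredT) => [|e]; last by rewrite inE.
pose term x c : F := ((i == x)%:R - (i == shift_mod x c)%:R)
  * (z ^+ x - z ^+ shift_mod x c).
rewrite -(pair_bigA _ (fun x (k : 'I_(size cs)) => term x (nth 0%N cs k))) /=.
rewrite exchange_big /=.
rewrite /circ_eigenvalue mulr_suml (big_nth 0%N) big_mkord.
apply: eq_bigr => k _.
move: (nth _ _ _) => c {k}.
have delta f : \sum_(x < N) (i == x)%:R * f x = f i :> F.
  rewrite (bigD1 i) //= eqxx mul1r big1 ?addr0 // => x.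
  by rewrite eq_sym => /negPf->; rewrite mul0r.
have shiftE (x : 'I_N) : z ^+ shift_mod x c = z ^+ x * z ^+ c.
  by rewrite /= expr_mod // exprD.
have shift_inj : injective (fun x : 'I_N => shift_mod x c).
  move=> x y /(congr1 val) /= /eqP; rewrite eqn_modDr => /eqP.
  by rewrite !modn_small // => /val_inj.
transitivity (\sum_(x < N) (i == x)%:R * (z ^+ x * (1 - z ^+ c)) -
   \sum_(x < N) (i == x)%:R * (z ^+ x * (z ^- c - 1))).
  rewrite [X in _ - X](reindex_inj shift_inj) -sumrB; apply: eq_bigr => x _.
  rewrite /term !shiftE mulrBl; congr (_ * _ - _ * _); first by ring.
  by field; rewrite expf_neq0.
by rewrite !delta; ring.
Qed.

Lemma sum_expr_root N (z : F) :
  z ^+ N = 1 -> \sum_(i < N) z ^+ i = if z == 1 then N%:R else 0.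
Proof.
move=> zN; case: eqVneq => [->|z1].
  by under eq_bigr => i _ do rewrite expr1n; rewrite sumr_const card_ord.
apply: (mulfI (x := z - 1)); first by rewrite subr_eq0.
by rewrite -subrX1 zN subrr mulr0.
Qed.

(** In the basis of the columns of the Fourier matrix [W] the Laplacian is
    diagonal. A row of ones added to row [0] makes it lower triangular, and on the
    diagonal only changes the eigenvalue 0 of the constant vector, to 1. *)
Lemma num_spanning_trees_circulant n cs (w : F) : n.+1.-primitive_root w ->
  (n.+1 * num_spanning_trees (circulant n.+1 cs))%:R =
  \prod_(1 <= j < n.+1) circ_eigenvalue cs (w ^+ j).
Proof.
move=> prim_w; set G := circulant n.+1 cs.
pose L := laplacian (@end1 G) (@end2 G) setT + \matrix_(i, j) (i == ord0)%:R.
have detL : \det L = (n.+1 * num_spanning_trees G)%:R.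
  by rewrite /L det_laplacian_row0 natrM; congr (_ * _); apply: matrix_tree.
pose v : 'rV[F]_n.+1 := \row_j w ^+ j.
pose W := Vandermonde n.+1 v.
pose T : 'M[F]_n.+1 := \matrix_(i, j)
  ((j == ord0)%:R + (i == j)%:R * circ_eigenvalue cs (w ^+ j)).
have wN (j : 'I_n.+1) : (w ^+ j) ^+ n.+1 = 1.
  by rewrite exprAC (prim_expr_order prim_w) expr1n.
have w1 (j : 'I_n.+1) : (w ^+ j == 1) = (j == ord0).
  by rewrite -(prim_order_dvd prim_w) /dvdn modn_small.
have LW : map_mx intr L *m W = W *m T.
  apply/matrixP=> i j; rewrite !mxE.
  transitivity (\sum_k ((laplacian (@end1 G) (@end2 G) setT i k)%:~R * (w ^+ j) ^+ k
      + (i == ord0)%:R * (w ^+ j) ^+ k)).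
    apply: eq_bigr => k _; rewrite -mulrDl !mxE rmorphD /= rmorph_nat.
    by congr (_ * _).
  rewrite big_split /= circulant_laplacian_mul // -mulr_sumr sum_expr_root // w1.
  transitivity (\sum_(k < n.+1) ((j == ord0)%:R * (w ^+ i) ^+ k
      + (k == j)%:R * (circ_eigenvalue cs (w ^+ j) * (w ^+ j) ^+ i))).
    rewrite big_split /= -mulr_sumr sum_expr_root // w1 -mulr_suml.
    rewrite (bigD1 j) //= eqxx big1 => [|k /negPf-> //].
    rewrite addr0 mul1r addrC; congr (_ + _).
    by case: (i == _); case: (j == _); rewrite ?mul1r ?mul0r ?mulr0.
  apply: eq_bigr => k _; rewrite !mxE; have [->|_] := eqVneq k j.
    rewrite exprAC; ring.
  by rewrite exprAC !mul0r !addr0 mulrC.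
have detW : \det W != 0.
  rewrite det_Vandermonde; apply/prodf_neq0 => i _; apply/prodf_neq0 => j ij.
  rewrite !mxE subr_eq0 (eq_prim_root_expr prim_w) !modn_small //.
  by rewrite gtn_eqF.
have Ttrig : is_trig_mx T.
  apply/is_trig_mxP=> i j ij; rewrite mxE.
  have -> : (j == ord0) = false.
    by rewrite -val_eqE /= gtn_eqF // (leq_ltn_trans _ ij).
  by rewrite -val_eqE /= ltn_eqF // mul0r addr0.
have := congr1 determinant LW; rewrite !det_mulmx mulrC => /(mulfI detW).
rewrite det_map_mx detL rmorph_nat => ->; rewrite (det_trig Ttrig).
rewrite big_ord_recl big_add1 big_mkord !mxE !eqxx mul1r.
rewrite /circ_eigenvalue expr0 big1_seq => [|c _]; last first.
  by rewrite expr1n invr1; ring.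
rewrite addr0 mul1r; apply: eq_bigr => j _.
by rewrite mxE eqxx mul1r lift0 add0r.
Qed.

End Eigenvalues.

(** * The eigenvalues as values of integer polynomials *)

(** [(x^c + x^-c - 2) / (x + x^-1 - 2)] as a polynomial in [x + x^-1]; the
    recursion is the Chebyshev one, with a correction for the constant [-2]. *)
Fixpoint eigen_quot (c : nat) : {poly int} :=
  if c is c1.+1 then
    if c1 is c2.+1 then 'X * eigen_quot c1 - eigen_quot c2 + 2%:R%:P else 1
  else 0.

Arguments eigen_quot : simpl never.

Lemma nat_ind2 (P : nat -> Prop) :
  P 0%N -> P 1%N -> (forall n, P n -> P n.+1 -> P n.+2) -> forall n, P n.
Proof.
move=> P0 P1 PS n; suff [] : P n /\ P n.+1 by [].
by elim: n => // n [Pn PSn]; auto.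
Qed.

Lemma eigen_quotSS c :
  eigen_quot c.+2 = 'X * eigen_quot c.+1 - eigen_quot c + 2%:R%:P.
Proof. by []. Qed.

Lemma eigen_quotP (F : fieldType) (z : F) c : z != 0 ->
  (2%:R - (z + z^-1)) * (map_poly intr (eigen_quot c)).[z + z^-1] =
  2%:R - z ^+ c - z ^- c.
Proof.
move=> z0; elim/nat_ind2: c => [||c IH0 IH1].
- by rewrite rmorph0 horner0 mulr0 expr0 invr1; ring.
- by rewrite rmorph1 hornerE expr1; ring.
rewrite eigen_quotSS rmorphD rmorphB rmorphM /= map_polyX map_polyC.
rewrite hornerD hornerD hornerN hornerM hornerX hornerC raddfMn /=.
rewrite mulr1z; move: IH0 IH1.
set t := z + z^-1; set p0 := _.[t]; set p1 := _.[t] => IH0 IH1.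
transitivity (t * ((2%:R - t) * p1) - (2%:R - t) * p0 + (2%:R - t) * 2%:R).
  by ring.
by rewrite IH0 IH1 !exprS /t; field; rewrite z0 expf_neq0.
Qed.

Lemma eigen_quot_N2 c : (eigen_quot c).[- 2%:R] = (odd c)%:R.
Proof.
elim/nat_ind2: c => [||c IH0 IH1]; [exact: horner0 | exact: hornerC |].
rewrite eigen_quotSS hornerD hornerD hornerN hornerM hornerX hornerC IH0 IH1.
rewrite /= negbK.
by case: (odd c).
Qed.

(** A Chebyshev polynomial of degree [m] in [x + x^-1]. With [N = 2 m + 1] if [e]
    and [N = 2 m + 2] otherwise, it is the quotient of [x^N - 1] by its factors
    [x - 1] and (for even [N]) [x + 1], up to a power of [x]. Thus its roots are
    one value [x + x^-1] for each pair of mutually inverse [N]-th roots of unity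
    other than 1 and -1. *)
Fixpoint pair_poly (e : bool) (m : nat) : {poly int} :=
  if m is m1.+1 then
    if m1 is m2.+1 then 'X * pair_poly e m1 - pair_poly e m2 else 'X + e%:R%:P
  else 1.

Arguments pair_poly : simpl never.

Lemma pair_polySS e m :
  pair_poly e m.+2 = 'X * pair_poly e m.+1 - pair_poly e m.
Proof. by []. Qed.

Lemma pair_poly_monic e m :
  size (pair_poly e m) = m.+1 /\ pair_poly e m \is monic.
Proof.
elim/nat_ind2: m => [||m [sz0 mon0] [sz1 mon1]].
- by rewrite size_poly1 monic1.
- by rewrite size_XaddC monicXaddC.
have sX : size ('X * pair_poly e m.+1) = m.+3.
  by rewrite mulrC size_mulX ?monic_neq0 // sz1.
rewrite pair_polySS size_polyDl ?size_polyN sX ?sz0 //; split=> //.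
rewrite monicE lead_coefDl ?size_polyN ?sX ?sz0 //.
by rewrite lead_coefM lead_coefX mul1r.
Qed.

(** The first factor is [z - 1] for [N] odd and [(z - 1) (z + 1)] for [N] even. *)
Lemma pair_polyP (F : fieldType) (z : F) e m : z != 0 ->
  (z ^+ (~~ e).+1 - 1) * z ^+ m * (map_poly intr (pair_poly e m)).[z + z^-1] =
  z ^+ (m.*2 + (~~ e).+1) - 1.
Proof.
move=> z0; elim/nat_ind2: m => [||m IH0 IH1].
- by rewrite rmorph1 hornerC !mulr1.
- rewrite rmorphD /= map_polyX map_polyC !hornerE raddfMn /= mulr1z.
  by case: e => /=; field.
rewrite pair_polySS rmorphB rmorphM /= map_polyX.
rewrite hornerD hornerN hornerM hornerX.
transitivity ((z ^+ 2 + 1) * (z ^+ (m.+1.*2 + (~~ e).+1) - 1) -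
   z ^+ 2 * (z ^+ (m.*2 + (~~ e).+1) - 1)).
  by rewrite -IH0 -IH1 !exprS; field.
by rewrite !doubleS !addSn !exprS; ring.
Qed.

(** The [t_j = w^j + w^-j], [1 <= j <= m], are roots by [pair_polyP], and they
    are distinct: [t_i = t_j] only if [w^i = w^j] or [w^i * w^j = 1]. As many as
    the degree, they are all the roots. *)
Lemma pair_poly_roots (F : fieldType) (w : F) e m :
    (m.*2 + (~~ e).+1).-primitive_root w ->
  map_poly intr (pair_poly e m) =
  \prod_(x <- [seq w ^+ j + w ^- j | j <- index_iota 1 m.+1]) ('X - x%:P).
Proof.
set N := (_ + _)%N => prim_w; have w0 := prim_root_neq0 prim_w.
have [sz mon] := pair_poly_monic e m.
have monF : map_poly intr (pair_poly e m) \is @monic F by rewrite monic_map.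
have szF : size (map_poly intr (pair_poly e m) : {poly F}) = m.+1.
  by rewrite size_map_poly_id0 // (monicP mon) oner_eq0.
rewrite [LHS](@all_roots_prod_XsubC _ _
  [seq w ^+ j + w ^- j | j <- index_iota 1 m.+1]).
- by rewrite (monicP monF) scale1r.
- by rewrite szF size_map size_iota subn1.
- apply/allP=> x /mapP[j]; rewrite mem_index_iota => /andP[j0 jm] ->.
  have := pair_polyP e m (expf_neq0 j w0).
  rewrite -/N [RHS]addrC [in RHS]exprAC (prim_expr_order prim_w).
  rewrite expr1n addrC subrr => /eqP; rewrite !mulf_eq0 => /orP[/orP[]|//].
    rewrite subr_eq0 -exprM -(prim_order_dvd prim_w) => /dvdn_leq; rewrite /N.
    by case: (e) => /=; lia.
  by rewrite expf_eq0 (negPf (expf_neq0 j w0)) andbF.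
rewrite uniq_rootsE map_inj_in_uniq ?iota_uniq // => i j.
rewrite !mem_index_iota => /andP[i0 im] /andP[j0 jm] /eqP.
have wi := expf_neq0 i w0; have wj := expf_neq0 j w0.
rewrite -subr_eq0.
have -> : w ^+ i + w ^- i - (w ^+ j + w ^- j) =
    (w ^+ i - w ^+ j) * (w ^+ i * w ^+ j - 1) / (w ^+ i * w ^+ j).
  by field; rewrite wi wj.
rewrite !mulf_eq0 invr_eq0 mulf_eq0 (negPf wi) (negPf wj) !orbF !subr_eq0.
case/orP; last first.
  by rewrite -exprD -(prim_order_dvd prim_w) => /dvdn_leq; rewrite /N; lia.
by rewrite (eq_prim_root_expr prim_w) !modn_small /N; lia.
Qed.

(** * The half product is an integer *)

Lemma prodr_scale (R : comPzRingType) I (r : seq I) (a : R) (f : I -> R) :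
  \prod_(i <- r) (a * f i) = a ^+ size r * \prod_(i <- r) f i.
Proof.
elim: r => [|i r IHr]; first by rewrite !big_nil mulr1.
by rewrite !big_cons IHr exprS mulrACA.
Qed.

(** Splitting [g] into linear factors [X - b] reduces this to the values of the
    characteristic polynomial at the points [b]. *)
Lemma det_horner_mx (F : closedFieldType) n (A : 'M[F]_n.+1) (g : {poly F}) rs :
  char_poly A = \prod_(x <- rs) ('X - x%:P) ->
  \det (horner_mx A g) = \prod_(x <- rs) g.[x].
Proof.
move=> cA; have size_rs : size rs = n.+1.
  by have := size_char_poly A; rewrite cA size_prod_XsubC => -[].
have det_sub c : \det (A - c%:M) = \prod_(x <- rs) (x - c).
  rewrite -opprB -scaleN1r detZ.
  have -> : \det (c%:M - A) = (char_poly A).[c].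
    rewrite -horner_evalE -det_map_mx; congr determinant.
    apply/matrixP=> i j.
    by rewrite !mxE /= horner_evalE !hornerE hornerMn hornerX.
  rewrite cA horner_prod -size_rs -prodr_scale.
  by apply: eq_bigr => x _; rewrite !hornerE; ring.
have [bs ->] := closed_field_poly_normal g.
rewrite linearZ /= detZ rmorph_prod /=.
have -> : \det (\prod_(b <- bs) horner_mx A ('X - b%:P)) =
    \prod_(b <- bs) \prod_(x <- rs) (x - b).
  elim: bs => [|b bs IHbs]; first by rewrite !big_nil det1.
  by rewrite !big_cons det_mulmx IHbs rmorphB /= horner_mx_X horner_mx_C det_sub.
rewrite exchange_big /= -size_rs.
rewrite -prodr_scale; apply: eq_bigr => x _.
rewrite hornerZ horner_prod; congr (_ * _).
by apply: eq_bigr => b _; rewrite !hornerE.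
Qed.

(** The product is the determinant of [g] at the companion matrix of [p]. *)
Lemma prod_over_roots_int (p g : {poly int}) (rs : seq algC) :
    p \is monic -> map_poly intr p = \prod_(x <- rs) ('X - x%:P) ->
  exists k : int, \prod_(x <- rs) (map_poly intr g).[x] = k%:~R.
Proof.
move=> mon_p pE; have := companionmxK mon_p.
have size_rs : size rs = (size p).-1.
  have := congr1 (fun q : {poly algC} => size q) pE.
  by rewrite size_prod_XsubC size_map_poly_id0 ?(monicP mon_p) ?oner_eq0 // => ->.
move: (companionmx p); rewrite -size_rs.
(* A companion matrix of size 0 has no ring structure, but the product is 1. *)
case: rs pE {size_rs} => [|x rs] pE A charA; first by exists 1; rewrite big_nil.
exists (\det (horner_mx A g)).
rewrite -det_map_mx map_horner_mx (det_horner_mx _ (rs := x :: rs)) //.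
by rewrite -map_char_poly charA.
Qed.

(** * Spanning trees of circulant graphs *)

Lemma prod_palindrome (R : comPzRingType) (f : nat -> R) m (b : bool) :
  let N := (m.*2 + b.+1)%N in
  (forall j, (0 < j < N)%N -> f (N - j)%N = f j) ->
  \prod_(1 <= j < N) f j =
  (if b then f m.+1 else 1) * (\prod_(1 <= j < m.+1) f j) ^+ 2.
Proof.
move=> N sym_f.
have mN : (m.+1 + b <= N)%N by rewrite /N; lia.
rewrite (big_cat_nat (n := m.+1)) ?(leq_trans (leq_addr b _) mN) //.
rewrite (big_cat_nat (m := m.+1) (n := (m.+1 + b)%N)) ?leq_addr //.
have -> : \prod_(m.+1 <= j < m.+1 + b) f j = if b then f m.+1 else 1.
  by case: b {N sym_f mN}; rewrite ?addn1 ?big_nat1 ?addn0 ?big_geq.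
suff -> : \prod_(m.+1 + b <= j < N) f j = \prod_(1 <= j < m.+1) f j.
  by rewrite /=; ring.
rewrite big_nat_rev -[X in index_iota X](add1n (m + b)) big_addn /=.
have -> : (N - (m + b) = m.+1)%N by rewrite /N; lia.
rewrite big_nat [RHS]big_nat; apply: eq_bigr => j jm.
rewrite -[RHS]sym_f; last by rewrite /N; lia.
by congr f; rewrite /N; lia.
Qed.

Lemma circ_eigenvalueE (F : fieldType) cs (z : F) : z != 0 ->
  circ_eigenvalue cs z = (1 - z) * (1 - z^-1) *
    (map_poly intr (\sum_(c <- cs) eigen_quot c)).[z + z^-1].
Proof.
move=> z0; rewrite rmorph_sum horner_sum mulr_sumr; apply: eq_bigr => c _.
by rewrite -(eigen_quotP c z0); congr (_ * _); field.
Qed.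

Lemma prod_1_subr_prim_root (F : fieldType) n (w : F) :
  n.+1.-primitive_root w -> \prod_(1 <= j < n.+1) (1 - w ^+ j) = n.+1%:R.
Proof.
move=> prim_w; have := factor_Xn_sub_1 prim_w.
rewrite big_ltn // expr0 subrX1 => /(mulfI (negbT (polyXsubC_eq0 1))).
move/(congr1 (fun q => q.[1])); rewrite horner_prod horner_sum.
under eq_bigr => j _ do rewrite !hornerE.
move=> ->; under eq_bigr => j _ do rewrite hornerXn expr1n.
by rewrite sumr_const card_ord.
Qed.

Lemma num_spanning_trees_eigen_quot (F : fieldType) n cs (w : F) :
    n.+1.-primitive_root w ->
  (num_spanning_trees (circulant n.+1 cs))%:R = n.+1%:R *
    \prod_(1 <= j < n.+1)
      (map_poly intr (\sum_(c <- cs) eigen_quot c)).[w ^+ j + w ^- j].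
Proof.
move=> prim_w; apply: (mulfI (prim_root_natf_neq0 prim_w)).
rewrite -natrM (num_spanning_trees_circulant _ prim_w) mulrA.
have w0 := prim_root_neq0 prim_w.
under eq_bigr => j _ do rewrite circ_eigenvalueE ?expf_neq0 //.
rewrite !big_split /= (prod_1_subr_prim_root prim_w); congr (_ * _ * _).
rewrite -(prod_1_subr_prim_root prim_w) [RHS]big_nat_rev !big_nat /=.
apply: eq_bigr => j /andP[j0 jn].
by rewrite add1n subSS (prim_expr_sub prim_w) // ltnW.
Qed.

(** The half product over [1 <= j <= n./2] is the square root. For even [n.+1]
    the middle index contributes [g(-2)], the number of odd jumps. *)
Lemma num_spanning_trees_circulant_square n cs : exists b : int,
  (num_spanning_trees (circulant n.+1 cs))%:Z =
  (n.+1 * (if odd n.+1 then 1 else count odd cs))%:Z * b ^+ 2.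
Proof.
have [w prim_w] := C_prim_root_exists (ltn0Sn n).
pose m := n./2; pose g := \sum_(c <- cs) eigen_quot c.
have nE : n.+1 = (m.*2 + (~~ ~~ odd n).+1)%N.
  by rewrite negbK -{1}(odd_double_half n) /m; lia.
have [_ mon] := pair_poly_monic (~~ odd n) m.
have := @pair_poly_roots _ w (~~ odd n) m; rewrite -nE => /(_ prim_w) pairE.
have [k] := prod_over_roots_int g mon pairE.
rewrite big_map => prodE.
exists k; apply: (@intr_inj algC).
rewrite rmorphM rmorphXn /= -!pmulrn (num_spanning_trees_eigen_quot _ prim_w) -/g.
pose f j := (map_poly intr g).[w ^+ j + w ^- j].
rewrite negbK in nE.
have := @prod_palindrome _ f m (odd n); rewrite -nE => ->; last first.
  move=> j /andP[_ jn].
  by rewrite /f (prim_expr_sub prim_w (ltnW jn)) invrK addrC.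
rewrite prodE natrM mulrA /=; congr (_ * _ * _).
case odd_n: (odd n) => //=; rewrite /f.
(* [m.+1] is half the order of [w]. *)
have -> : w ^+ m.+1 = -1.
  have : (w ^+ m.+1) ^+ 2 == 1.
    rewrite -exprM -(prim_expr_order prim_w); apply/eqP; congr (w ^+ _).
    by rewrite nE odd_n; lia.
  rewrite sqrf_eq1 => /orP[|/eqP //].
  by rewrite -(prim_order_dvd prim_w) => /dvdn_leq; rewrite nE odd_n; lia.
have -> : -1 + (-1)^-1 = (- 2%:R : int)%:~R :> algC.
  by rewrite invrN1 rmorphN rmorph_nat; ring.
suff gN2 : g.[- 2%:R] = (count odd cs)%:Z by rewrite horner_map /= gN2.
rewrite /g horner_sum; elim: (cs) => [|c cs' IHcs]; first by rewrite big_nil.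
by rewrite big_cons IHcs eigen_quot_N2 /= PoszD; case: (odd c).
Qed.

Local Close Scope ring_scope.

(** If [x = 0], which occurs when no jump is odd, [z = 0] serves. *)
Lemma sqfree_part_square x : exists z, x = sqfree_part x * z ^ 2.
Proof.
case: (posnP x) => [->|x0]; first by exists 0; rewrite muln0.
by have /(is_sqfree_partP _ x0)[_ [z [_ xE]]] := sqfree_partP x0; exists z.
Qed.

Theorem theorem2
  (k l beta : nat) (s : k.-tuple nat) (alpha : l.-tuple nat)
  (hk : 1 <= k) (hbeta : 1 <= beta)
  (s_pos : all (fun c => 1 <= c) s) (s_incr : sorted ltn s)
  (alpha_range : all (fun a => 1 <= a <= beta %/ 2) alpha)
  (alpha_incr : sorted ltn alpha) :
  let G (n : nat) := circulant (beta * n) (s ++ [seq a * n | a <- alpha]) in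
  let tau (n : nat) := num_spanning_trees (G n) in
  let p := count odd s in
  let q := count odd alpha in
  let r := sqfree_part p in
  let sq := sqfree_part (p + q) in
  exists a : nat -> int,
    forall n : nat,
      0 < n -> last 0 s <= (beta * n) %/ 2 -> connected (G n) ->
      [/\ odd n -> odd beta ->
            (tau n)%:Z%R = ((beta * n)%:Z * a n ^+ 2)%R,
          ~~ odd n ->
            (tau n)%:Z%R = ((beta * r * n)%:Z * a n ^+ 2)%R
        & odd n -> ~~ odd beta ->
            (tau n)%:Z%R = ((beta * sq * n)%:Z * a n ^+ 2)%R].
Proof.
move=> G tau p q r sq.
pose coef n := if odd n then if odd beta then 1 else sq else r.
have root n : exists a,
    (0 < n) ==> (Posz (tau n) == (beta * coef n * n)%:Z * a ^+ 2)%R.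
  case: n => [|n]; first by exists 0%R.
  have := num_spanning_trees_circulant_square (beta * n.+1).-1
    (s ++ [seq a * n.+1 | a <- alpha]).
  rewrite prednK ?muln_gt0 ?hbeta // -/(G n.+1) -/(tau n.+1) => -[b tauE].
  have [z cz] : exists z, (if odd (beta * n.+1) then 1
      else count odd (s ++ [seq a * n.+1 | a <- alpha])) = coef n.+1 * z ^ 2.
    have count_alpha : count odd [seq a * n.+1 | a <- alpha] = odd n.+1 * q.
      rewrite count_map /q; case on: (odd n.+1); last first.
        rewrite (eq_count (a2 := pred0)) ?count_pred0 // => a.
        by rewrite /= oddM on andbF.
      by rewrite mul1n; apply: eq_count => a; rewrite /= oddM on andbT.
    rewrite count_cat count_alpha oddM andbC /coef.
    case: (odd n.+1) => /=; last first.
      by rewrite mul0n addn0; apply: sqfree_part_square.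
    case: (odd beta) => /=; first by exists 1.
    by rewrite mul1n; apply: sqfree_part_square.
  exists (Posz z * b)%R; apply/eqP; rewrite [LHS]tauE cz.
  by rewrite -mulnn !PoszM; ring.
exists (fun n => xchoose (root n)) => n n0 _ _.
move: (xchoose _) (implyP (xchooseP (root n)) n0) => a /eqP.
rewrite /coef; case: (odd n); case: (odd beta) => -> /=; split=> // _ _.
by rewrite muln1.
Qed.
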